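(* Let $\Omega$ be a bounded convex domain in $\mathbb{R}^n$. The topology on $\Omega$ induced by the Funk metric $F_\Omega$ coincides with the Euclidean topology of $\Omega$, and likewise the topology on $\Omega$ induced by the reverse Funk metric ${}^rF_\Omega$ coincides with the Euclidean topology of $\Omega$.
   Context: A convex domain is a non-empty open convex subset $\Omega\subset\mathbb{R}^n$. For bounded $\Omega$ and $x\neq y$ in $\Omega$, let $a_\Omega(x,y)$ be the unique intersection point of the ray $\{x+t(y-x):t\ge0\}$ with $\partial\Omega$. The Funk metric is $F_\Omega(x,x)=0$ and $F_\Omega(x,y)=\log\frac{|x-a|}{|y-a|}$ with $a=a_\Omega(x,y)$ for $x\ne y$. The reverse Funk metric is ${}^rF_\Omega(x,y)=F_\Omega(y,x)$. The topology induced by $F_\Omega$ is the one generated by the forward open balls $\{y\in\Omega: F_\Omega(x,y)<\rho\}$ ($x\in\Omega,\rho>0$); the topology induced by ${}^rF_\Omega$ is the one generated by the sets $\{y\in\Omega: F_\Omega(y,x)<\rho\}$. *)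

(* Defs.v *)
From HB Require Import structures.
From mathcomp Require Import all_boot all_order all_algebra.
From mathcomp Require Import all_classical all_reals all_analysis.
Import Order.TTheory GRing.Theory Num.Theory.
Import numFieldNormedType.Exports.

Set Implicit Arguments.
Unset Strict Implicit.
Unset Printing Implicit Defensive.

Local Open Scope classical_set_scope.
Local Open Scope ring_scope.

Section Topology.
Variable T : Type.

(* The empty set is the union of the empty subfamily. *)
Definition is_topology (O : set (set T)) : Prop :=
  [/\ O setT,
      forall A B : set T, O A -> O B -> O (A `&` B) &
      forall S : set (set T), S `<=` O -> O (\bigcup_(A in S) A)].

Definition generated_topology (G : set (set T)) : set (set T) :=
  smallest is_topology G.

End Topology.

Section Funk.
Variables (R : realType) (n : nat).
Implicit Types (Omega : set 'rV[R]_n) (x y : 'rV[R]_n).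

(* The norm that the library puts on 'rV[R]_n is the sup norm. It induces the
   same topology and the same bounded sets as this one. *)
Definition eucl_norm x : R := Num.sqrt (\sum_(i < n) x ord0 i ^+ 2).

Definition convex_domain Omega : Prop :=
  [/\ Omega !=set0, open Omega & convex_set Omega].

Definition boundary Omega : set 'rV[R]_n := closure Omega `\` Omega°.

Definition ray x y : set 'rV[R]_n :=
  [set x + t *: (y - x) | t in [set t : R | 0 <= t]].

(* When Omega is a bounded convex domain and x != y lie in Omega, the
   intersection is a singleton, so that get returns its unique point. *)
Definition funk_exit Omega x y : 'rV[R]_n :=
  get (ray x y `&` boundary Omega).

Definition funk Omega x y : R :=
  if x == y then 0
  else let a := funk_exit Omega x y in
       ln (eucl_norm (x - a) / eucl_norm (y - a)).

Definition reverse_funk Omega x y : R := funk Omega y x.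

(* The topology on the subtype of points of Omega generated by the forward
   balls of d. *)
Definition ball_topology Omega (d : 'rV[R]_n -> 'rV[R]_n -> R) :
    set (set Omega) :=
  generated_topology
    [set B : set Omega | exists (x : Omega) (rho : R),
       0 < rho /\ B = [set y : Omega | d (val x) (val y) < rho]].

(* The type Omega carries the library's subspace topology, initial for val. *)
Definition euclidean_topology Omega : set (set Omega) :=
  [set U : set Omega | open U].

End Funk.

Arguments ball_topology {R n} Omega d.
Arguments euclidean_topology {R n} Omega.

(* Main.v *)
Require Import Defs.
From mathcomp Require Import all_boot all_order all_algebra.
From mathcomp Require Import all_classical all_reals all_analysis.
From mathcomp Require Import ring lra.
Import Order.TTheory GRing.Theory Num.Theory.
Import numFieldNormedType.Exports.

Local Open Scope classical_set_scope.
Local Open Scope ring_scope.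

(** Fix [x] in [Omega] and [y <> x] in [Omega], and let
    [a = x + t *: (y - x)] be the point where the ray from [x] through [y]
    meets the boundary. Since the three points are collinear, the quotient of
    distances in the Funk metric is [t / (t - 1)], a decreasing function of
    [t > 1]. Writing a radius as [rho = ln (r / (r - 1))] with [r > 1], the
    inequality [funk Omega x y < rho] therefore means [r < t]. As [Omega] is
    open and convex, the ray lies in [Omega] exactly up to the parameter [t]
    ([convex_open_ray]), so
<<
      funk Omega x y < ln (r / (r - 1))  <->  Omega (x + r *: (y - x))
>>
    which is [funk_lt]; it also holds when [x = y].

    Both topologies are read off from this equivalence. For fixed [r] the point
    [x + r *: (y - x)] is continuous in [y] and in [x], so that the forward
    balls of [funk] and of [reverse_funk] are preimages of [Omega] and hence
    open. Conversely, if [x], [y] and [z = x + r *: (y - x)] lie in [Omega]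
    and [M] bounds the norm on [Omega], then [r *: (y - x) = z - x] and
    [(r - 1) *: (y - x) = z - y] have norm at most [2 * M]; when [r] is large,
    that is when [rho] is small, the balls lie in a given neighbourhood of
    their centre. By [ball_topology_euclidean] these two facts suffice. *)

(** * Rays in open convex sets *)

Lemma convex_set_segment (R : realType) (V : normedModType R) (A : set V)
    (x y : V) (t : R) :
  convex_set A -> A x -> A y -> 0 <= t <= 1 -> A (x + t *: (y - x)).
Proof.
move=> cA Ax Ay /andP[t0 t1].
have t01 : Itv.spec (@Itv.num_sem R) (Itv.Real `[0%Z, 1%Z]) t.
  by apply/and3P; split; [exact: ger0_real | rewrite bnd_simp | rewrite bnd_simp].
have := cA y x (Itv.mk t01) (mem_set Ay) (mem_set Ax).
rewrite inE; congr (A _); rewrite /conv /=.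
by rewrite /unstable.onem scalerBl scale1r scalerBr addrCA.
Qed.

Lemma continuous_line (R : realType) (V : normedModType R) (x v : V) :
  continuous (fun t : R => x + t *: v).
Proof.
move=> t; apply: cvgD; first exact: cvg_cst.
exact: scalel_continuous.
Qed.

(** This lemma and the next one make the forward balls of the Funk metric and of
    its reverse open. *)
Lemma open_extrapolation_to (R : realType) (V : normedModType R) (A : set V)
    (x : V) (r : R) :
  open A -> open [set y | A (x + r *: (y - x))].
Proof.
apply: open_comp => y _; apply: cvgD; first exact: cvg_cst.
by apply: cvgZl_tmp; apply: cvgB; [exact: cvg_id | exact: cvg_cst].
Qed.

Lemma open_extrapolation_from (R : realType) (V : normedModType R) (A : set V)
    (x : V) (r : R) :
  open A -> open [set y | A (y + r *: (x - y))].
Proof.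
apply: open_comp => y _; apply: cvgD; first exact: cvg_id.
by apply: cvgZl_tmp; apply: cvgB; [exact: cvg_cst | exact: cvg_id].
Qed.

(** The half-open segment from a point of an open convex set to a point of its
    closure stays in the set. *)
Lemma convex_open_closure_segment (R : realType) (V : normedModType R)
    (A : set V) (x a : V) (u : R) :
  open A -> convex_set A -> A x -> closure A a -> 0 <= u < 1 ->
  A (x + u *: (a - x)).
Proof.
move=> oA cA Ax cla /andP[u0 u1].
have u1_neq0 : 1 - u != 0 by rewrite subr_eq0 eq_sym lt_eqF.
set p := x + u *: (a - x).
(* p is the point of parameter u on the segment from h b to b, and h a = x,
   so that h b is in A for b in A close to a. *)
pose h (b : V) : V := (1 - u)^-1 *: (p - u *: b).
have ha : h a = x.
  rewrite /h /p [u *: (a - x)]scalerBr -addrA addrAC subrr sub0r -{1}(scale1r x).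
  by rewrite -scalerBl scalerA mulVf// scale1r.
have nha : nbhs a (h @^-1` A).
  have ch : {for a, continuous h}.
    apply: cvgZl_tmp; apply: cvgB; first exact: cvg_cst.
    exact: scaler_continuous.
  by apply: ch; rewrite ha; exact: open_nbhs_nbhs.
have [b [Ab Ahb]] := cla _ nha.
have -> : p = h b + u *: (b - h b).
  rewrite scalerBr addrCA -{1}(scale1r (h b)) -scalerBl.
  by rewrite /h scalerA mulfV// scale1r addrC subrK.
by apply: convex_set_segment => //; rewrite u0 ltW.
Qed.

(** A ray that starts in an open convex set [A] leaves [A] once and for all at
    any point of its closure that is not in [A]. *)
Lemma convex_open_ray (R : realType) (V : normedModType R)
    (A : set V) (x v : V) (t r : R) :
  open A -> convex_set A -> A x -> 0 <= t -> 0 <= r ->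
  closure A (x + t *: v) -> ~ A (x + t *: v) -> A (x + r *: v) <-> r < t.
Proof.
move=> oA cA Ax t0 r0 clt nAt.
have tpos : 0 < t.
  rewrite lt_neqAle t0 andbT; apply/eqP => t0E.
  by apply: nAt; rewrite -t0E scale0r addr0.
split=> [Ar|rt].
  rewrite ltNge; apply/negP => tr; apply: nAt.
  have rpos : 0 < r by exact: lt_le_trans tr.
  have -> : t *: v = (t / r) *: (x + r *: v - x).
    by rewrite addrAC subrr add0r scalerA mulfVK// gt_eqF.
  apply: convex_set_segment => //.
  by rewrite divr_ge0//= ler_pdivrMr// mul1r.
have -> : r *: v = (r / t) *: (x + t *: v - x).
  by rewrite addrAC subrr add0r scalerA mulfVK// gt_eqF.
apply: convex_open_closure_segment => //.
by rewrite divr_ge0//= ltr_pdivrMr// mul1r.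
Qed.

Lemma bounded_set_norm_le (R : realType) (V : normedModType R) (A : set V) :
  bounded_set A -> exists2 M : R, 0 < M & forall x, A x -> `|x| <= M.
Proof.
move=> /pinfty_ex_gt0[M M0 hM]; exists M => // x Ax; exact: hM.
Qed.

Lemma bounded_open_ray_exit (R : realType) (V : normedModType R) (A : set V)
    (x v : V) :
  open A -> bounded_set A -> A x -> v != 0 ->
  exists t : R, [/\ 0 <= t, closure A (x + t *: v) & ~ A (x + t *: v)].
Proof.
move=> oA /bounded_set_norm_le[M M0 hM] Ax v0.
have nv : 0 < `|v| by rewrite normr_gt0.
pose S := [set t : R | 0 <= t /\ A (x + t *: v)].
have S0 : S 0 by split; rewrite // scale0r addr0.
have ubS : has_ubound S.
  exists ((M + `|x|) / `|v|) => t [t0 At].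
  rewrite ler_pdivlMr// -{1}(ger0_norm t0) -normrZ.
  rewrite -[t *: v](addrK x) [t *: v + x]addrC.
  by rewrite (le_trans (ler_normB _ _))// lerD2r hM.
have s0 : 0 <= sup S by exact: ub_le_sup.
exists (sup S); split => //.
  have clS : closed ((fun t : R => x + t *: v) @^-1` closure A).
    by apply: (continuous_closedP _).1; [exact: continuous_line|exact: closed_closure].
  apply: clS; apply: (@closure_subset _ S).
    by move=> t [_ At]; exact: subset_closure.
  by apply: closure_sup => //; exists 0.
(* If the ray were in A at sup S, it would stay in A a little further. *)
move=> As.
have : nbhs (sup S) ((fun t : R => x + t *: v) @^-1` A).
  by apply: continuous_line; exact: open_nbhs_nbhs.
move=> /nbhs_ballP[e /= e0 he].
have : S (sup S + e / 2).
  split; first by rewrite addr_ge0// divr_ge0// ltW.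
  apply: he; rewrite /ball/= opprD addrA subrr sub0r normrN gtr0_norm; lra.
by move=> /(ub_le_sup ubS); lra.
Qed.

(** * Balls of the Funk metric *)

Lemma eucl_normZ (R : realType) (n : nat) (c : R) (v : 'rV[R]_n) :
  eucl_norm (c *: v) = `|c| * eucl_norm v.
Proof.
rewrite /eucl_norm -sqrtr_sqr -sqrtrM ?sqr_ge0//; congr Num.sqrt.
by rewrite mulr_sumr; apply: eq_bigr => i _; rewrite mxE exprMn.
Qed.

Lemma eucl_norm_gt0 (R : realType) (n : nat) (v : 'rV[R]_n) :
  v != 0 -> 0 < eucl_norm v.
Proof.
move=> v0; rewrite sqrtr_gt0 lt_neqAle sumr_ge0 ?andbT; last first.
  by move=> i _; exact: sqr_ge0.
apply: contra v0; rewrite eq_sym psumr_eq0; last by move=> i _; exact: sqr_ge0.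
move=> /allP v0; apply/eqP/rowP => i; rewrite mxE.
by apply/eqP; rewrite -sqrf_eq0; apply: v0; exact: mem_index_enum.
Qed.

(** The ball of radius [ln (r / (r - 1))] of the Funk metric, read without the
    exit point. *)
Lemma funk_lt (R : realType) (n : nat) (Omega : set 'rV[R]_n)
    (x y : 'rV[R]_n) (r : R) :
  convex_domain Omega -> bounded_set Omega -> Omega x -> Omega y -> 1 < r ->
  funk Omega x y < ln (r / (r - 1)) <-> Omega (x + r *: (y - x)).
Proof.
move=> [_ oO cO] bO Ox Oy r1; rewrite /funk.
have r10 : 0 < r - 1 by rewrite subr_gt0.
have r0 : 0 < r by lra.
have [<-|xy] := eqVneq x y.
  rewrite subrr scaler0 addr0; split => // _.
  by rewrite ln_gt0// ltr_pdivlMr// mul1r; lra.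
have yx : y - x != 0 by rewrite subr_eq0 eq_sym.
have nyx : eucl_norm (y - x) != 0 by rewrite gt_eqF// eucl_norm_gt0.
have [] : (ray x y `&` boundary Omega) (funk_exit Omega x y).
  have [t [t0 clt nt]] := bounded_open_ray_exit _ _ _ _ (y - x) oO bO Ox yx.
  apply: (@getPex _ (ray x y `&` boundary Omega)).
  exists (x + t *: (y - x)); split; first by exists t.
  by split => // /interior_subset.
move=> [t /= t0 <-] [clt nt].
have {}nt : ~ Omega (x + t *: (y - x)).
  by move=> Oa; apply: nt; exact: open_nbhs_nbhs.
have t1 : 1 < t.
  apply/(convex_open_ray _ _ _ _ (y - x) _ 1 oO cO Ox t0 ler01 clt nt).
  by rewrite scale1r addrC subrK.
have tpos : 0 < t by lra.
have t10 : 0 < t - 1 by rewrite subr_gt0.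
rewrite (convex_open_ray _ _ _ _ _ t r oO cO Ox t0 (ltW r0) clt nt).
have -> : x - (x + t *: (y - x)) = - t *: (y - x).
  by rewrite opprD addrA subrr sub0r scaleNr.
have -> : y - (x + t *: (y - x)) = (1 - t) *: (y - x).
  by rewrite opprD addrA scalerBl scale1r.
rewrite !eucl_normZ normrN (gtr0_norm tpos) (distrC 1) (gtr0_norm t10).
rewrite -mulf_div divff// mulr1.
rewrite ltr_ln ?posrE ?divr_gt0//.
rewrite ltr_pdivrMr// mulrAC ltr_pdivlMr//.
by split; nra.
Qed.

(** The positive radii are the numbers [ln (r / (r - 1))] with [r > 1]. *)
Lemma funk_radiusP (R : realType) (rho : R) :
  0 < rho <-> exists2 r : R, 1 < r & rho = ln (r / (r - 1)).
Proof.
split=> [rho0|[r r1 ->]]; last first.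
  by rewrite ln_gt0// ltr_pdivlMr ?subr_gt0// mul1r; lra.
have e1 : 1 < expR rho by rewrite expR_gt1.
exists (expR rho / (expR rho - 1)).
  by rewrite ltr_pdivlMr ?subr_gt0// mul1r; lra.
rewrite -[LHS]expRK; congr ln; field; lra.
Qed.

(** * Topologies generated by balls *)

(** Forward balls that are open, and that contain their centre and shrink into
    each of its neighbourhoods, generate the subspace topology. *)
Lemma ball_topology_euclidean (R : realType) (n : nat) (Omega : set 'rV[R]_n)
    (d : 'rV[R]_n -> 'rV[R]_n -> R) :
  (forall x rho, Omega x -> 0 < rho -> exists2 V : set 'rV[R]_n, open V &
     forall y, Omega y -> d x y < rho <-> V y) ->
  (forall x e, Omega x -> 0 < e -> exists2 rho, 0 < rho &
     d x x < rho /\ forall y, Omega y -> d x y < rho -> `|x - y| < e) ->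
  ball_topology Omega d = euclidean_topology Omega.
Proof.
move=> ball_open ball_small; rewrite /ball_topology /generated_topology.
apply/seteqP; split.
  apply: smallest_sub.
    split; first exact: openT.
      by move=> A B; exact: openI.
    by move=> S So; apply: bigcup_open => A SA; exact: So.
  move=> _ [x [rho [rho0 ->]]].
  have [V oV VE] := ball_open _ _ (set_valP x) rho0.
  exists V => //; apply/seteqP; split=> y /=; by move=> /(VE _ (set_valP y)).
move=> _ [V oV <-] M [[_ _ MU] GM].
pose S := [set B : set Omega | (exists (x : Omega) (rho : R),
  0 < rho /\ B = [set y : Omega | d (val x) (val y) < rho]) /\
  B `<=` val @^-1` V].
suff -> : set_val @^-1` V = \bigcup_(B in S) B by apply: MU => B [/GM].
apply/seteqP; split=> [x Vx|x [B [_ BV] /BV]//].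
have /nbhs_ballP[e /= e0 eV] : nbhs (val x) V by exact: open_nbhs_nbhs.
have [rho rho0 [dxx small]] := ball_small _ _ (set_valP x) e0.
exists [set y : Omega | d (val x) (val y) < rho] => //; split.
  by exists x, rho.
move=> y /= dxy; apply: eV; rewrite -ball_normE /=.
exact: small (set_valP y) dxy.
Qed.

Lemma funk_ball_topology (R : realType) (n : nat) (Omega : set 'rV[R]_n) :
  convex_domain Omega -> bounded_set Omega ->
  ball_topology Omega (funk Omega) = euclidean_topology Omega.
Proof.
move=> domO bO; have [_ oO _] := domO.
apply: ball_topology_euclidean => [x _ Ox /funk_radiusP[r r1 ->]|x e Ox e0].
  exists [set y | Omega (x + r *: (y - x))]; last by move=> y Oy; exact: funk_lt.
  exact: open_extrapolation_to.
have [M M0 hM] := bounded_set_norm_le _ _ _ bO.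
(* Points of Omega are at distance at most 2 * M, and r * e > 2 * M. *)
pose r := 1 + (2 * M) / e.
have r1 : 1 < r by rewrite ltrDl divr_gt0// mulr_gt0.
have rho0 : 0 < ln (r / (r - 1)) by apply/funk_radiusP; exists r.
exists (ln (r / (r - 1))) => //; split; first by rewrite /funk eqxx.
move=> y Oy /(funk_lt _ _ _ _ _ _ domO bO Ox Oy r1) Oz.
have r0 : 0 < r by lra.
have : r * `|x - y| <= 2 * M.
  rewrite distrC -{1}(gtr0_norm r0) -normrZ -[r *: _](addrK x) [_ + x]addrC.
  by rewrite (le_trans (ler_normB _ _))// mulr_natl mulr2n lerD ?hM.
rewrite -[2 * M](mulfVK (lt0r_neq0 e0)) => le2M.
rewrite -(ltr_pM2l r0); apply: le_lt_trans le2M _.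
by rewrite ltr_pM2r// ltrDr.
Qed.

Lemma reverse_funk_ball_topology (R : realType) (n : nat)
    (Omega : set 'rV[R]_n) :
  convex_domain Omega -> bounded_set Omega ->
  ball_topology Omega (reverse_funk Omega) = euclidean_topology Omega.
Proof.
move=> domO bO; have [_ oO _] := domO; rewrite /reverse_funk.
apply: ball_topology_euclidean => [x _ Ox /funk_radiusP[r r1 ->]|x e Ox e0].
  exists [set y | Omega (y + r *: (x - y))]; last by move=> y Oy; exact: funk_lt.
  exact: open_extrapolation_from.
have [M M0 hM] := bounded_set_norm_le _ _ _ bO.
(* Points of Omega are at distance at most 2 * M, and (r - 1) * e > 2 * M. *)
pose r := 2 + (2 * M) / e.
have Me0 : 0 < (2 * M) / e by rewrite divr_gt0// mulr_gt0.
have r1 : 1 < r by rewrite /r; lra.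
have rho0 : 0 < ln (r / (r - 1)) by apply/funk_radiusP; exists r.
exists (ln (r / (r - 1))) => //; split; first by rewrite /funk eqxx.
move=> y Oy /(funk_lt _ _ _ _ _ _ domO bO Oy Ox r1) Oz.
have r0 : 0 < r - 1 by lra.
have : (r - 1) * `|x - y| <= 2 * M.
  rewrite -{1}(gtr0_norm r0) -normrZ scalerBl scale1r opprB addrCA addrA.
  by rewrite (le_trans (ler_normB _ _))// mulr_natl mulr2n lerD ?hM.
rewrite -[2 * M](mulfVK (lt0r_neq0 e0)) => le2M.
rewrite -(ltr_pM2l r0); apply: le_lt_trans le2M _.
by rewrite ltr_pM2r// /r; lra.
Qed.

Theorem proposition6p1 (R : realType) (n : nat) (Omega : set 'rV[R]_n)
    (domOmega : convex_domain Omega) (bndOmega : bounded_set Omega) :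
  ball_topology Omega (funk Omega) = euclidean_topology Omega /\
  ball_topology Omega (reverse_funk Omega)
    = euclidean_topology Omega.
Proof.
by split; [exact: funk_ball_topology | exact: reverse_funk_ball_topology].
Qed.
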